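(* Let $G$ be the graph with vertex set $\{s,t,v_0,\dots,v_5,u_0,\dots,u_5\}$ and edges $$\{s,v_0\},\{v_0,v_1\},\{v_1,v_2\},\{v_2,v_3\},\{v_3,v_4\},\{v_4,v_1\},\{v_3,v_5\},\{v_5,t\},$$ $$\{s,u_0\},\{u_0,u_1\},\{u_1,u_2\},\{u_2,u_3\},\{u_3,u_4\},\{u_4,u_1\},\{u_3,u_5\},\{u_5,t\}.$$ Then $G$ is a $2$-edge-connected planar graph for which it is impossible to have a $2$-resilient source-matched routing scheme (for the source-destination pair $(s,t)$) against dynamic failures without rewriting bits in packet headers.
   Context: Dynamic failures: a set $F\subseteq E$ of unstable links; each link of $F$ may alternate arbitrarily between up and down over time (when down it fails in both directions), including while a packet travels; links outside $F$ are always up. Source-matched routing scheme for $(s,t)$ without header rewriting: every node $v\ne t$ has a static deterministic forwarding function, which may depend on both the source $s$ and the destination $t$, whose input is the in-port of the packet (or $\bot$ if the packet originates at $v$) and the set of links incident to $v$ that are currently up, and whose output is an outgoing link at $v$. It is $k$-resilient against dynamic failures if for every set $F$ of dynamic failures with $|F|\le k$ such that $s$ and $t$ are connected in $G\setminus F$ (the graph with all of $F$ removed), a packet originating at $s$ is delivered to $t$, however the states of the links of $F$ evolve. Non-trap assumption (standing): it is assumed that the dynamic failures in $F$ cannot lead the routing functions to direct a packet across different connected components of $G\setminus F$. *)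

(* Defs.v *)
From HB Require Import structures.
From mathcomp Require Import all_boot all_order all_algebra.
From mathcomp Require Import classical_sets set_interval reals topology normedtype.

Set Implicit Arguments.
Unset Strict Implicit.
Unset Printing Implicit Defensive.

Import numFieldNormedType.Exports.

Record sgraph := SGraph {
  svertex :> finType;
  sedge : rel svertex;
  sedge_sym : symmetric sedge;
  sedge_irrefl : irreflexive sedge }.

Definition links (G : sgraph) : {set {set G}} :=
  [set [set p.1; p.2]%SET | p : G * G & sedge p.1 p.2]%SET.

Definition remove_links (G : sgraph) (F : {set {set G}}) : rel G :=
  [rel x y | sedge x y && ([set x; y]%SET \notin F)].

Definition edge_connected (k : nat) (G : sgraph) : Prop :=
  1 < #|G| /\
  forall F : {set {set G}}, F \subset links G -> #|F| < k ->
    forall x y : G, connect (remove_links F) x y.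

Section Planarity.
Local Open Scope classical_set_scope.
Local Open Scope ring_scope.

(* A drawing of G in the plane: [arc x y] is a simple arc from the point of x
   to the point of y; arcs avoid all vertices except at their ends and meet
   each other at most there.  The two orientations of a link share one curve. *)
Definition planar (R : realType) (G : sgraph) : Prop :=
  exists (pos : G -> R * R) (arc : G -> G -> R -> R * R),
  [/\ injective pos,
      forall x y, sedge x y ->
        [/\ {within `[0, 1], continuous (arc x y)},
            {in `[0, 1] &, injective (arc x y)},
            arc x y 0 = pos x,
            arc x y 1 = pos y
          & forall a, arc y x a = arc x y (1 - a)],
      forall x y z a, sedge x y -> a \in `]0, 1[ -> arc x y a <> pos z
    & forall x y x' y' a b, sedge x y -> sedge x' y' ->
        [set x; y]%SET <> [set x'; y']%SET ->
        a \in `]0, 1[ -> b \in `]0, 1[ -> arc x y a <> arc x' y' b].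

End Planarity.

Section Routing.
Variable G : sgraph.

(* As G is simple, the port of v towards a neighbour w is identified with w.
   The arguments are the node, its in-port ([None] for a packet originating at
   the node) and the set of ports whose link is up; the result is the out-port. *)
Definition forwarding := G -> option G -> {set G} -> G.

(* The first argument is the source, the second one the destination. *)
Definition source_matched := G -> G -> forwarding.

Definition up_ports (D : {set {set G}}) (x : G) : {set G} :=
  [set y | remove_links D x y]%SET.

(* One forwarding decision for a packet at c.1 with in-port c.2 while exactly
   the links of D are down.  A packet at the destination t stays there; a packet
   sent to anything but an up port is lost ([None]). *)
Definition hop (f : forwarding) (t : G) (D : {set {set G}})
    (c : G * option G) : option (G * option G) :=
  if c.1 == t then Some c else
  let y := f c.1 c.2 (up_ports D c.1) in
  if y \in up_ports D c.1 then Some (y, Some c.1) else None.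

(* [D n] is the set of links that are down when the packet takes its n-th hop. *)
Fixpoint run (f : forwarding) (s t : G) (D : nat -> {set {set G}}) (n : nat)
    : option (G * option G) :=
  if n is m.+1 then obind (hop f t (D m)) (run f s t D m) else Some (s, None).

Definition delivered (f : forwarding) (s t : G) (D : nat -> {set {set G}}) : Prop :=
  exists n p, run f s t D n = Some (t, p).

(* The failures D never get the packet out of the component of G \ F that
   contains its source. *)
Definition non_trapping (F : {set {set G}}) (f : forwarding) (s t : G)
    (D : nat -> {set {set G}}) : Prop :=
  forall n x p, run f s t D n = Some (x, p) -> connect (remove_links F) s x.

Definition dynamic_resilient (k : nat) (f : source_matched) (s t : G) : Prop :=
  forall F : {set {set G}}, F \subset links G -> #|F| <= k ->
    connect (remove_links F) s t ->
    forall D : nat -> {set {set G}},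
      (forall n, D n \subset F) -> non_trapping F (f s t) s t D ->
      delivered (f s t) s t D.

End Routing.

Inductive vertex14 :=
  | src | dst | v0 | v1 | v2 | v3 | v4 | v5 | u0 | u1 | u2 | u3 | u4 | u5.

Definition vertex14_code (x : vertex14) : nat :=
  match x with
  | src => 0 | dst => 1
  | v0 => 2 | v1 => 3 | v2 => 4 | v3 => 5 | v4 => 6 | v5 => 7
  | u0 => 8 | u1 => 9 | u2 => 10 | u3 => 11 | u4 => 12 | u5 => 13
  end.

Definition vertex14_enum : seq vertex14 :=
  [:: src; dst; v0; v1; v2; v3; v4; v5; u0; u1; u2; u3; u4; u5].

Lemma vertex14_codeK : cancel vertex14_code (nth src vertex14_enum).
Proof. by case. Qed.

HB.instance Definition _ := Countable.copy vertex14 (can_type vertex14_codeK).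

Lemma vertex14_enumP : Finite.axiom vertex14_enum.
Proof. by case. Qed.

HB.instance Definition _ := isFinite.Build vertex14 vertex14_enumP.

Definition edges14 : seq (vertex14 * vertex14) :=
  [:: (src, v0); (v0, v1); (v1, v2); (v2, v3); (v3, v4); (v4, v1); (v3, v5);
      (v5, dst);
      (src, u0); (u0, u1); (u1, u2); (u2, u3); (u3, u4); (u4, u1); (u3, u5);
      (u5, dst)].

Definition adj14 : rel vertex14 :=
  [rel x y | ((x, y) \in edges14) || ((y, x) \in edges14)].

Lemma adj14_sym : symmetric adj14.
Proof. by move=> x y; exact: orbC. Qed.

Lemma adj14_irrefl : irreflexive adj14.
Proof. by case. Qed.

Definition G14 : sgraph := SGraph adj14_sym adj14_irrefl.

(* Main.v *)
(* Non-resilience: say that src first sends the packet to v0 (u0 is the mirror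
   image). Turning back when another link is up can be made to repeat forever,
   so v0, v2 and v4 pass packets on, src hands a packet coming back from v0 to
   u0, and v1 returns a packet from v2 (v4) to v0 if its link to v4 (v2) is down.
   Say that v1, with all links up, sends a packet from v0 to v2 (v4 is the
   symmetric case). If v1 then sends a packet from v2 to v0 or back to v2, it is
   caught between a failure of v2v3 and, in the first case, one of src-u0.
   If v1 sends it to v4, take F = {v3v4, v3v5}: v3 is a dead end returning the
   packet to v2, so that it either bounces on v2v3 or tours the 4-cycle forever,
   the adversary letting v3v4 be up just when the packet is about to go from v4
   to v3. All these traps are loops of at most nine hops, checked by computation. *)
Require Import Defs.
From mathcomp Require Import classical_sets topology normedtype.
From mathcomp Require Import all_boot all_order all_algebra reals.
From mathcomp Require Import ring.

Set Implicit Arguments.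
Unset Strict Implicit.
Unset Printing Implicit Defensive.

Import Order.TTheory GRing.Theory Num.Theory numFieldNormedType.Exports.

(** Losing the packet serves the adversary as well as keeping it on the orbit of [next], so both
    outcomes are allowed at each hop. *)
Lemma run_follows (G : sgraph) (f : forwarding G) s t D
    (next : G * option G -> G * option G) (c0 := (s, None)) :
  (forall n, let c := iter n next c0 in
     hop f t (D n) c = None \/ hop f t (D n) c = Some (next c)) ->
  forall n, run f s t D n = None \/ run f s t D n = Some (iter n next c0).
Proof.
move=> hopP; elim=> [|n /= [->|->]]; [by right | by left |].
exact: hopP.
Qed.

(** * Computable failure sets and 2-edge-connectivity *)

Notation link := (vertex14 * vertex14)%type.

Definition cut (d : seq link) : {set {set G14}} :=
  [set [set p.1; p.2] | p in d].

Lemma set2_eq (T : finType) (a b x y : T) :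
  ([set a; b] == [set x; y]) = ((a == x) && (b == y)) || ((a == y) && (b == x)).
Proof.
apply/eqP/idP => [/setP E|]; last first.
  by case/orP=> /andP[/eqP-> /eqP->] //; rewrite setUC.
move: (E a) (E b) (E x) (E y); rewrite !inE !eqxx /= ?orbT.
rewrite (eq_sym x a) (eq_sym x b) (eq_sym y a) (eq_sym y b).
by do 4 case: eqP => //=.
Qed.

Lemma in_cut d (x y : G14) :
  ([set x; y]%SET \in cut d) = ((x, y) \in d) || ((y, x) \in d).
Proof.
apply/imsetP/orP => [[[a b] abd /= /eqP]|[] xyd].
- by rewrite set2_eq => /orP[] /andP[/eqP-> /eqP->]; [left | right].
- by exists (x, y).
- by exists (y, x); rewrite //= setUC.
Qed.

Lemma cut_links d : all (fun p => adj14 p.1 p.2) d -> cut d \subset links G14.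
Proof.
move=> /allP adjd; apply/subsetP => _ /imsetP[p pd ->].
by apply/imsetP; exists p; rewrite // inE; apply: adjd.
Qed.

Lemma card_cut d : #|cut d| <= size d.
Proof. exact: leq_trans (leq_imset_card _ _) (card_size _). Qed.

Definition ups (d : seq link) (x : vertex14) : seq vertex14 :=
  [seq y <- vertex14_enum
     | [&& adj14 x y, (x, y) \notin d & (y, x) \notin d]].

Lemma mem_vertex14_enum x : x \in vertex14_enum.
Proof. by case: x. Qed.

Lemma up_ports_cut d x : up_ports (G := G14) (cut d) x = [set y in ups d x]%SET.
Proof.
apply/setP => y.
by rewrite !inE /remove_links /= in_cut negb_or mem_filter mem_vertex14_enum andbT.
Qed.

(* The order of the links makes two forward and backward sweeps reach
   everything from src, whichever two links are cut. *)
Definition sweep (d : seq link) (s : seq vertex14) :=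
  let links := edges14 ++ rev [seq (e.2, e.1) | e <- edges14] in
  foldl (fun s e => if [&& e.1 \in s, e.2 \notin s, e \notin d & (e.2, e.1) \notin d]
                    then e.2 :: s else s) s links.

Definition reach d := sweep d (sweep d [:: src]).

(** Soundness suffices: every later check asks that a vertex be reached, never that it be missed. *)
Lemma sweepP d s :
  {in s, forall x, connect (remove_links (G := G14) (cut d)) src x} ->
  {in sweep d s, forall x, connect (remove_links (G := G14) (cut d)) src x}.
Proof.
rewrite /sweep; set l := _ ++ _.
have: {in l, forall e, adj14 e.1 e.2} by apply/allP.
elim: l s => [|[a b] l IHl] s adjl //= sP; apply: IHl.
  by move=> e el; apply: adjl; rewrite inE el orbT.
case: ifP => // /and4P[/= aP _ abd bad] x; rewrite inE => /predU1P[->|]; last exact: sP.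
apply: connect_trans (sP _ aP) (connect1 _).
rewrite /remove_links /= in_cut negb_or abd bad !andbT.
exact: (adjl (a, b) (mem_head _ _)).
Qed.

Lemma reachP d x : x \in reach d -> connect (remove_links (G := G14) (cut d)) src x.
Proof. by do 2 apply: sweepP; move=> y; rewrite inE => /eqP->; exact: connect0. Qed.

Lemma remove_links_sym (G : sgraph) F : connect_sym (remove_links (G := G) F).
Proof.
by apply: sym_connect_sym => x y; rewrite /remove_links /= sedge_sym setUC.
Qed.

Lemma edge_connected_G14 : edge_connected 2 G14.
Proof.
split; first by apply/card_gt1P; exists src, dst.
(* Up to orientation, these 17 lists give all failure sets with fewer than two links. *)
have reachT : all (fun d => all (fun x => x \in reach d) vertex14_enum)
    ([::] :: [seq [:: (e.1, e.2)] | e <- edges14]).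
  by vm_compute.
have conn d : d \in [::] :: [seq [:: (e.1, e.2)] | e <- edges14] ->
    forall x y : G14, connect (remove_links (cut d)) x y.
  move=> dP x y; have /allP rT := allP reachT d dP.
  have srcP z : connect (remove_links (G := G14) (cut d)) src z.
    by apply: reachP; apply: rT (mem_vertex14_enum z).
  by apply: connect_trans (srcP y); rewrite remove_links_sym.
move=> F /subsetP FG; rewrite ltnS leq_eqVlt ltnS leqn0 cards_eq0.
case/orP=> [/cards1P[e Fe]|/eqP->]; last first.
  suff -> : set0 = cut [::] by apply: conn.
  by apply/setP => e; rewrite inE; apply/esym/imsetP => -[].
have /imsetP[[a b] abP e_ab] : e \in links G14 by apply: FG; rewrite Fe set11.
have Fcut c : [set c.1; c.2]%SET = e -> F = cut [:: (c.1, c.2)].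
  rewrite Fe => <-; apply/setP => A; rewrite inE.
  apply/eqP/imsetP => [->|[p]]; first by exists (c.1, c.2); rewrite ?mem_head.
  by rewrite inE => /eqP->.
have dP c : c \in edges14 ->
    [:: (c.1, c.2)] \in [::] :: [seq [:: (e.1, e.2)] | e <- edges14].
  by move=> cP; rewrite inE; apply/orP; right; apply/mapP; exists c.
(* A link is an unordered pair, but [edges14] lists a single orientation of it. *)
move: abP; rewrite inE => /orP[] abP.
  by rewrite (Fcut (a, b) (esym e_ab)); apply: conn (dP _ abP).
have e_ba : [set b; a]%SET = e by rewrite setUC e_ab.
by rewrite (Fcut (b, a) e_ba); apply: conn (dP _ abP).
Qed.

(** * Refutation trees and their soundness *)

Notation config := (vertex14 * option vertex14)%type.

(* A refutation of a forwarding function: [Ask x p d k] looks up where x sends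
   a packet with in-port p while exactly d is down, and goes on according to the
   answer.  [Trap F up] ends it: the adversary keeps the links of F down, except
   that it lifts them all when the packet is in a configuration of up. *)
Inductive refutation :=
  | Trap of seq link & seq config
  | Ask of vertex14 & option vertex14 & seq link & (vertex14 -> refutation).

(** A node sees only its own links, so answers are keyed by the up ports and serve all failure sets
    that look alike there. *)
Definition decision : Type := config * seq vertex14.

Fixpoint lookup (A : seq (decision * vertex14)) (k : decision) : option vertex14 :=
  if A is (k', y) :: A' then if k' == k then Some y else lookup A' k else None.

(* A packet with a single port up has to take it. *)
Definition decide (A : seq (decision * vertex14)) (k : decision) :=
  if k.2 is [:: y] then Some y else lookup A k.

Definition down (F : seq link) (up : seq config) (c : config) :=
  if c \in up then [::] else F.

(** The default [c.1] is never reached in an accepted trap: [refutes] checks that [decide] answers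
    along the orbit. *)
Definition step A F up (c : config) : config :=
  (odflt c.1 (decide A (c, ups (down F up c) c.1)), Some c.1).

(** An orbit that returns among its first ten configurations never leaves them, so ten checks cover
    the infinite run. Staying in [R] makes the run non-trapping. *)
Fixpoint refutes (A : seq (decision * vertex14)) (r : refutation) : bool :=
  match r with
  | Trap F up =>
    let s := traject (step A F up) (src, None) 10 in
    let R := reach F in
    [&& size F <= 2, all (fun e => adj14 e.1 e.2) F, dst \in R,
        all (fun c : config => [&& c.1 != dst, c.1 \in R
               & decide A (c, ups (down F up c) c.1) : bool]) s
      & looping (step A F up) (src, None) 10]
  | Ask x p d k =>
    let U := ups d x in
    (U != [::]) && all (fun y => refutes (((x, p, U), y) :: A) (k y)) U
  end.

(* A router that loses packets does no better than one that sends them along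
   some link that is up. *)
Definition clip (f : forwarding G14) (k : decision) : vertex14 :=
  let y := f k.1.1 k.1.2 [set z in k.2]%SET in
  if y \in k.2 then y else head src k.2.

Lemma clip_in f k : k.2 != [::] -> clip f k \in k.2.
Proof.
rewrite /clip; case: ifP => // _.
by case: k => c [|y U] //= _; exact: mem_head.
Qed.

Lemma clip_nil f k y : k.2 = [:: y] -> clip f k = y.
Proof. by rewrite /clip => ->; rewrite inE; case: eqP. Qed.

Lemma hop_clip f d (c : config) : c.1 != dst ->
  hop (G := G14) f dst (cut d) c = None \/
  hop (G := G14) f dst (cut d) c = Some (clip f (c, ups d c.1), Some c.1).
Proof.
move=> /negPf c1; rewrite /hop c1 up_ports_cut in_set /clip /=.
by case: ifP => _; [right | left].
Qed.

Lemma decideP (f : forwarding G14) A k y :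
  (forall k y, lookup A k = Some y -> clip f k = y) ->
  decide A k = Some y -> clip f k = y.
Proof.
rewrite /decide => fA; case kU: k.2 => [|z [|z' U]]; try exact: fA.
by case=> <-; apply: clip_nil kU.
Qed.

Lemma refutesP (f : source_matched G14) A r :
  (forall k y, lookup A k = Some y -> clip (f src dst) k = y) ->
  refutes A r -> ~ dynamic_resilient 2 f (src : G14) (dst : G14).
Proof.
elim: r A => [F up|x p d k IHk] A fA; last first.
  case/andP=> U0 /allP kU; set K := (x, p, ups d x).
  (* All possible answers were checked; the branch of the actual one is followed. *)
  apply: (IHk (clip (f src dst) K) ((K, clip (f src dst) K) :: A)); last first.
    by apply: kU; exact: (clip_in _ (k := K)).
  by move=> k' y /=; case: eqP => [<- [] //|_]; exact: fA.
case/and5P=> szF linksF dstR /allP good /loopingP loop res.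
set next := step A F up in good loop.
pose c n := iter n next (src, None).
have {}good n : [/\ (c n).1 != dst, (c n).1 \in reach F
    & next (c n) = (clip (f src dst) (c n, ups (down F up (c n)) (c n).1), Some (c n).1)].
  have /good/and3P[-> ->] := loop n; rewrite -/(c n) /next /step.
  by case E: (decide _ _) => [y|] //= _; rewrite (decideP fA E).
(* Forwarding is deterministic, so the adversary can schedule the failures along the orbit known in
   advance. *)
pose D n := cut (down F up (c n)).
have runP : forall n, run (G := G14) (f src dst) src dst D n = None \/
    run (G := G14) (f src dst) src dst D n = Some (c n).
  apply: run_follows => m /=; have [dstc _ nextc] := good m.
  by rewrite nextc; exact: hop_clip.
have [|||n|n x p|n [p]] := res (cut F) _ _ _ D.
- exact: cut_links.
- exact: leq_trans (card_cut F) szF.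
- exact: reachP.
- rewrite /D /down; case: ifP => // _; apply/subsetP => e /imsetP[] //.
- by have [|] := runP n => -> // [cn]; have [_ /reachP] := good n; rewrite cn.
by have [|] := runP n => -> // [cn]; have [/eqP] := good n; rewrite cn.
Qed.

(** * The refutation for [G14] *)

Definition mirror (x : vertex14) : vertex14 :=
  match x with
  | src => src | dst => dst
  | v0 => u0 | v1 => u1 | v2 => u2 | v3 => u3 | v4 => u4 | v5 => u5
  | u0 => v0 | u1 => v1 | u2 => v2 | u3 => v3 | u4 => v4 | u5 => v5
  end.

(** The symmetry acts on the certificate, which is then checked afresh, so no invariance of
    [refutes] has to be proved. Answers are translated back by [mirror], an involution. *)
Fixpoint mirror_refutation (r : refutation) : refutation :=
  let mirror_links := map (fun e : link => (mirror e.1, mirror e.2)) in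
  match r with
  | Trap F up =>
    Trap (mirror_links F) [seq (mirror c.1, omap mirror c.2) | c <- up]
  | Ask x p d k =>
    Ask (mirror x) (omap mirror p) (mirror_links d)
        (fun y => mirror_refutation (k (mirror y)))
  end.

(* Here v0 is known to pass packets on both ways, src to send those coming back
   from v0 to u0, and v1 to return a packet that comes from v2 (v4) to v0 if its
   link to v4 (v2) is down. *)
Definition refutation_v1 : refutation :=
  Ask v1 (Some v0) [::] (fun y => match y with
  | v0 => Trap [:: (src, v0)] [:: (src, None)]
  | v2 =>
    Ask v1 (Some v2) [::] (fun y => match y with
    | v0 => Trap [:: (src, u0); (v2, v3)] [::]
    | v2 => Trap [:: (v2, v3)] [::]
    | _ =>
      Ask v2 (Some v3) [::] (fun y => match y with
      | v1 => Trap [:: (v3, v4); (v3, v5)] [:: (v4, Some v1)]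
      | _ => Trap [:: (v3, v4); (v3, v5)] [::]
      end)
    end)
  | _ =>
    Ask v1 (Some v4) [::] (fun y => match y with
    | v0 => Trap [:: (src, u0); (v3, v4)] [::]
    | v4 => Trap [:: (v3, v4)] [::]
    | _ =>
      Ask v4 (Some v3) [::] (fun y => match y with
      | v1 => Trap [:: (v2, v3); (v3, v5)] [:: (v2, Some v1)]
      | _ => Trap [:: (v2, v3); (v3, v5)] [::]
      end)
    end)
  end).

(** In each trap listed here the packet ends up bouncing on one link: one end has no other link up,
    the other gave the answer just asked. A configuration in [up] lets the packet cross a link of
    [F] on its way in. *)
Definition refutation_v : refutation :=
  Ask v0 (Some src) [::] (fun y => if y == src then Trap [:: (src, u0)] [::] else
  Ask v1 (Some v0) [:: (v1, v4)] (fun y =>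
    if y == v0 then Trap [:: (src, v0); (v1, v4)] [:: (src, None)] else
  Ask v1 (Some v0) [:: (v1, v2)] (fun y =>
    if y == v0 then Trap [:: (src, v0); (v1, v2)] [:: (src, None)] else
  Ask v2 (Some v1) [::] (fun y =>
    if y == v1 then Trap [:: (v0, v1); (v1, v4)] [:: (v0, Some src)] else
  Ask v4 (Some v1) [::] (fun y =>
    if y == v1 then Trap [:: (v0, v1); (v1, v2)] [:: (v0, Some src)] else
  Ask u0 (Some src) [::] (fun y => if y == src then Trap [:: (src, v0)] [::] else
  Ask src (Some v0) [::] (fun y => if y == v0 then Trap [:: (v0, v1)] [::] else
  Ask v0 (Some v1) [::] (fun y =>
    if y == v1 then Trap [:: (v1, v2); (v1, v4)] [::] else
  Ask v1 (Some v2) [:: (v1, v4)] (fun y =>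
    if y == v2 then Trap [:: (v2, v3); (v1, v4)] [::] else
  Ask v1 (Some v4) [:: (v1, v2)] (fun y =>
    if y == v4 then Trap [:: (v1, v2); (v3, v4)] [::] else
  refutation_v1)))))))))).

Lemma not_resilient_G14 (f : source_matched G14) :
  ~ dynamic_resilient 2 f (src : G14) (dst : G14).
Proof.
have ref : refutes [::] (Ask src None [::] (fun y =>
  if y == v0 then refutation_v else mirror_refutation refutation_v)).
  by vm_compute.
exact: refutesP ref.
Qed.

(** * Planarity by a straight-line drawing *)

Section StraightLineDrawing.
Local Open Scope ring_scope.

(** Twice the signed area of the triangle [p q z]. *)
Definition orient (R : pzRingType) (p q z : R * R) : R :=
  (q.1 - p.1) * (z.2 - p.2) - (q.2 - p.2) * (z.1 - p.1).

Definition segment (R : pzRingType) (p q : R * R) (a : R) : R * R :=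
  ((1 - a) * p.1 + a * q.1, (1 - a) * p.2 + a * q.2).

(** One of [z], [w] may lie on the line [p q], as happens when two links share a vertex. *)
Definition same_side (R : realDomainType) (p q z w : R * R) : bool :=
  (0 <= orient p q z * orient p q w) &&
  ((orient p q z != 0) || (orient p q w != 0)).

Lemma orient_segment (R : comPzRingType) (p q z w : R * R) a :
  orient p q (segment z w a) = (1 - a) * orient p q z + a * orient p q w.
Proof. by rewrite /orient /=; ring. Qed.

Lemma orient_on_segment (R : comPzRingType) (p q : R * R) a :
  orient p q (segment p q a) = 0.
Proof. by rewrite /orient /=; ring. Qed.

Lemma segment_rev (R : pzRingType) (p q : R * R) a :
  segment q p a = segment p q (1 - a).
Proof. by rewrite /segment subKr; congr (_, _); rewrite addrC. Qed.

Lemma segment_inj (R : idomainType) (p q : R * R) : p != q -> injective (segment p q).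
Proof.
case: p q => [p1 p2] [q1 q2]; rewrite xpair_eqE negb_and => pq a b [E1 E2].
have {}E1 : (a - b) * (q1 - p1) = 0.
  transitivity ((1 - a) * p1 + a * q1 - ((1 - b) * p1 + b * q1)); first by ring.
  by rewrite E1 subrr.
have {}E2 : (a - b) * (q2 - p2) = 0.
  transitivity ((1 - a) * p2 + a * q2 - ((1 - b) * p2 + b * q2)); first by ring.
  by rewrite E2 subrr.
move: (congr1 (eq_op^~ 0) E1) (congr1 (eq_op^~ 0) E2).
rewrite eqxx !mulf_eq0 !subr_eq0 (eq_sym q1) (eq_sym q2).
by case: eqP => //= _ E1' E2'; move: pq; rewrite E1' E2'.
Qed.

Lemma same_side_disjoint (R : realFieldType) (p q z w : R * R) a b :
  same_side p q z w -> 0 < b < 1 -> segment p q a <> segment z w b.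
Proof.
move=> /andP[zw zw0] /andP[b0 b1] /(congr1 (orient p q)).
rewrite orient_on_segment orient_segment => /esym/eqP.
move: (orient p q z) (orient p q w) zw zw0 => x y xy xy0.
have b1' : 0 < 1 - b by rewrite subr_gt0.
(* Squaring avoids cases on signs: the cross term is nonnegative like [x * y], and one of the
   squares is positive. *)
rewrite -sqrf_eq0 gt_eqF //.
have -> : ((1 - b) * x + b * y) ^+ 2 =
  ((1 - b) * x) ^+ 2 + (b * y) ^+ 2 + 2 * (b * (1 - b) * (x * y)) by ring.
apply: ltr_wpDr; first by rewrite mulr_ge0 // mulr_ge0 // mulr_ge0 // ltW.
by rewrite lt_neqAle addr_ge0 ?sqr_ge0 // andbT eq_sym paddr_eq0 ?sqr_ge0 //
  !sqrf_eq0 !mulf_eq0 (gt_eqF b0) (gt_eqF b1') negb_and.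
Qed.

Lemma segment_continuous (R : realType) (p q : R * R) : continuous (segment p q).
Proof.
move=> a; have cvg_coord u v : continuous (fun b : R => (1 - b) * u + b * v).
  move=> b; apply: cvgD; apply: cvgMl; last exact: cvg_id.
  by apply: cvgB; [exact: cvg_cst | exact: cvg_id].
exact: cvg_pair (cvg_coord _ _ a) (cvg_coord _ _ a).
Qed.

(** Integer coordinates make all sign tests computable; the morphism into [R] preserves their
    outcome. *)
Definition point (R : pzRingType) (p : int * int) : R * R := (p.1%:~R, p.2%:~R).

Lemma orient_point (R : pzRingType) (p q z : int * int) :
  orient (point R p) (point R q) (point R z) = (orient p q z)%:~R.
Proof. by rewrite /orient /= !(rmorphB, rmorphM). Qed.

Lemma same_side_point (R : realDomainType) (p q z w : int * int) :
  same_side (point R p) (point R q) (point R z) (point R w) = same_side p q z w.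
Proof. by rewrite /same_side !orient_point -rmorphM /= ler0z !intr_eq0. Qed.

Lemma point_inj (R : numDomainType) : injective (point R).
Proof. by move=> [a b] [c d] [/intr_inj-> /intr_inj->]. Qed.

(** Two links are kept apart by the line through one of them. An arc meets its own ends only at 0
    and 1 by injectivity, and the other vertices lie off its line. *)
Lemma straight_line_planar (R : realType) (G : sgraph) (pos : G -> int * int) :
  injective pos ->
  (forall x y z, sedge x y -> z != x -> z != y -> orient (pos x) (pos y) (pos z) != 0) ->
  (forall x y x' y', sedge x y -> sedge x' y' -> [set x; y]%SET <> [set x'; y']%SET ->
     same_side (pos x) (pos y) (pos x') (pos y') ||
     same_side (pos x') (pos y') (pos x) (pos y)) ->
  planar R G.
Proof.
move=> pos_inj off_line sep; pose P x := point R (pos x).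
have P_inj : injective P by move=> x y /point_inj/pos_inj.
have P_neq x y : sedge x y -> P x != P y.
  by apply: contraL => /eqP/P_inj->; rewrite sedge_irrefl.
have in01 (a : R) : a \in `]0, 1[ -> 0 < a < 1 by rewrite in_itv.
have segment0 p q : segment p q 0 = p :> R * R.
  by rewrite /segment subr0 !mul0r !mul1r !addr0; case: p.
have segment1 p q : segment p q 1 = q :> R * R.
  by rewrite /segment subrr !mul0r !mul1r !add0r; case: q.
exists P, (fun x y => segment (P x) (P y)); split=> //.
- move=> x y xy; split=> //.
  + exact/continuous_subspaceT/segment_continuous.
  + by move=> a b _ _; exact: segment_inj (P_neq x y xy) _ _.
  + exact: segment_rev.
- move=> x y z a xy /in01/andP[a0 a1].
  have arc_inj := segment_inj (P_neq x y xy).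
  have [->|zx] := eqVneq z x.
    by rewrite -{2}(segment0 (P x) (P y)) => /arc_inj a_eq; rewrite a_eq ltxx in a0.
  have [->|zy] := eqVneq z y.
    by rewrite -{2}(segment1 (P x) (P y)) => /arc_inj a_eq; rewrite a_eq ltxx in a1.
  move/(congr1 (orient (P x) (P y)))/esym/eqP.
  by rewrite orient_on_segment orient_point intr_eq0 (negPf (off_line _ _ _ xy zx zy)).
- move=> x y x' y' a b xy xy' neq /in01 a01 /in01 b01.
  have /orP[ss|ss] := sep _ _ _ _ xy xy' neq.
    by apply: same_side_disjoint b01; rewrite same_side_point.
  by move/esym; apply: same_side_disjoint a01; rewrite same_side_point.
Qed.

Definition pos14 (x : vertex14) : int * int :=
  match x with
  | src => (0, 0) | dst => (8, 0)
  | v0 => (1, 1) | v1 => (2, 3) | v2 => (4, 5)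
  | v3 => (6, 3) | v4 => (4, 1) | v5 => (7, 1)
  | u0 => (1, -1) | u1 => (2, -3) | u2 => (4, -5)
  | u3 => (6, -3) | u4 => (4, -1) | u5 => (7, -1)
  end.

Lemma planar_G14 (R : realType) : planar R G14.
Proof.
have allV (Q : pred vertex14) : all Q vertex14_enum -> forall x, Q x.
  by move=> /allP QT x; apply: QT; exact: mem_vertex14_enum.
apply: (@straight_line_planar R G14 pos14).
- suff inj : all (fun x => all (fun y => (pos14 x == pos14 y) ==> (x == y))
      vertex14_enum) vertex14_enum.
    by move=> x y xy; have /allV/(_ y) := allV _ inj x; rewrite xy eqxx => /eqP.
  by vm_compute.
- suff off_line : all (fun x => all (fun y => all (fun z => adj14 x y ==>
      [|| z == x, z == y | orient (pos14 x) (pos14 y) (pos14 z) != 0])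
      vertex14_enum) vertex14_enum) vertex14_enum.
    move=> x y z xy zx zy; have /allV/(_ y)/allV/(_ z) := allV _ off_line x.
    by rewrite (negPf zx) (negPf zy); move/implyP; apply.
  by vm_compute.
- suff sep : all (fun x => all (fun y => adj14 x y ==>
      all (fun x' => all (fun y' => adj14 x' y' ==>
        [|| (x == x') && (y == y'), (x == y') && (y == x'),
            same_side (pos14 x) (pos14 y) (pos14 x') (pos14 y')
          | same_side (pos14 x') (pos14 y') (pos14 x) (pos14 y)])
      vertex14_enum) vertex14_enum) vertex14_enum) vertex14_enum.
    move=> x y x' y' xy xy' /eqP; rewrite set2_eq negb_or => /andP[/negPf n1 /negPf n2].
    have /allV/(_ y)/implyP/(_ xy)/allV/(_ x')/allV/(_ y') := allV _ sep x.
    by rewrite n1 n2 => /implyP; apply.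
  by vm_compute.
Qed.

End StraightLineDrawing.

Theorem theorem14 (R : realType) :
  [/\ edge_connected 2 G14,
      planar R G14
    & ~ exists f : source_matched G14, dynamic_resilient 2 f (src : G14) (dst : G14)].
Proof.
split; [exact: edge_connected_G14 | exact: planar_G14 |].
by move=> [f]; exact: not_resilient_G14.
Qed.
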